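(* Let $M$ be a $po$-$\Gamma$-semigroup. The following are equivalent: (1) $M$ is intra-regular. (2) $N(x)=\{y\in M \mid x\in (M\Gamma y\Gamma M]\}$ for every $x\in M$. (3) $\mathcal{N}=\mathcal{I}$. (4) For every ideal $I$ of $M$, we have $I=\bigcup_{x\in I}(x)_{\mathcal{N}}$. (5) $(x)_{\mathcal{N}}$ is a simple subsemigroup of $M$ for every $x\in M$. (6) $M$ is a semilattice of simple semigroups. (7) Every ideal of $M$ is semiprime.
   Context: A $po$-$\Gamma$-semigroup is a nonempty set $M$ with a nonempty set $\Gamma$ of binary operations on $M$, satisfying $(a\gamma b)\mu c=a\gamma(b\mu c)$ for all $a,b,c\in M$ and $\gamma,\mu\in\Gamma$, and a partial order $\le$ on $M$ such that $a\le b$ implies $a\gamma c\le b\gamma c$ and $c\gamma a\le c\gamma b$ for all $c\in M$, $\gamma\in\Gamma$. For $A,B\subseteq M$, $A\Gamma B=\{a\gamma b\mid a\in A,\ b\in B,\ \gamma\in\Gamma\}$ (and similarly for longer products, with singletons written as elements; e.g. $M\Gamma x\gamma x\Gamma M=\{a\delta x\gamma x\xi b\mid a,b\in M,\ \delta,\xi\in\Gamma\}$ for fixed $\gamma$). For $H\subseteq M$, $(H]=\{t\in M\mid t\le a \text{ for some } a\in H\}$. $M$ is intra-regular if $x\in(M\Gamma x\gamma x\Gamma M]$ for every $x\in M$ and every $\gamma\in\Gamma$. An ideal of $M$ is a nonempty subset $A$ with $M\Gamma A\subseteq A$, $A\Gamma M\subseteq A$, and such that $a\in A$, $b\in M$,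 $b\le a$ imply $b\in A$. $I(a)$ denotes the ideal of $M$ generated by $a$, and $\mathcal{I}$ is the equivalence relation $a\,\mathcal{I}\,b\Leftrightarrow I(a)=I(b)$. A subset $T$ of $M$ is semiprime if $a\in M$, $\gamma\in\Gamma$, $a\gamma a\in T$ imply $a\in T$. A subsemigroup of $M$ is a nonempty subset $A$ with $A\Gamma A\subseteq A$; it is itself a $po$-$\Gamma$-semigroup with the restricted operations and order. A $po$-$\Gamma$-semigroup is simple if it is the only ideal of itself; a subsemigroup is simple if it is simple as a $po$-$\Gamma$-semigroup in its own right. A filter of $M$ is a subsemigroup $F$ such that (i) $a,b\in M$, $\gamma\in\Gamma$, $a\gamma b\in F$ imply $a\in F$ and $b\in F$; (ii) $a\in F$, $c\in M$, $c\ge a$ imply $c\in F$. $N(x)$ denotes the filter of $M$ generated by $x$ (the smallest filter containing $x$), $\mathcal{N}$ is the equivalence relation $a\,\mathcal{N}\,b\Leftrightarrow N(a)=N(b)$, and $(x)_{\mathcal{N}}$ is the $\mathcal{N}$-class of $x$. A congruence on $M$ is an equivalence relation $\sigma$ such that $(a,b)\in\sigma$ implies $(a\gamma c,b\gamma c)\in\sigma$ and $(c\gamma a,c\gamma b)\in\sigma$ for all $c\in M$, $\gamma\in\Gamma$. It is a semilattice congruence if $(a\gamma b,b\gamma a)\in\sigma$ and $(a\gamma a,a)\in\sigma$ for all $a,b\in M$, $\gamma\in\Gamma$. $M$ is a semilattice of simple semigroups if there is a semilattice congruence $\sigma$ on $M$ such that the $\sigma$-class $(x)_\sigma$ is a simple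 subsemigroup of $M$ for every $x\in M$. *)

(* Defs.v *)
From HB Require Import structures.
From mathcomp Require Import all_boot all_order.
From mathcomp Require Import boolp classical_sets.
From Corelib Require RelationClasses.
Set Implicit Arguments.
Unset Strict Implicit.
Unset Printing Implicit Defensive.

Local Open Scope classical_set_scope.
Local Open Scope order_scope.

Record poGammaSemigroup (d : Order.disp_t) := PoGammaSemigroup {
  carrier :> porderType d;
  Gamma : set (carrier -> carrier -> carrier);
  carrier_nonempty : [set: carrier] !=set0;
  Gamma_nonempty : Gamma !=set0;
  gammaA : forall g m, Gamma g -> Gamma m ->
    forall a b c, m (g a b) c = g a (m b c);
  gamma_monor : forall g, Gamma g -> forall a b c, a <= b -> g a c <= g b c;
  gamma_monol : forall g, Gamma g -> forall a b c, a <= b -> g c a <= g c b }.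

Arguments Gamma {d} p.

Section Notions.
Context {d : Order.disp_t} {M : poGammaSemigroup d}.
Implicit Types (A B H I T F : set M) (x y : M) (sigma : M -> M -> Prop).

Definition gprod A B : set M :=
  \bigcup_(g in Gamma M) [set g a b | a in A & b in B].

(* The operation g is fixed; the outer two range over Gamma. *)
Definition MxgxM (g : M -> M -> M) x : set M :=
  gprod [set g u v | u in gprod [set: M] [set x] & v in [set x]] [set: M].

Definition MyM y : set M := gprod (gprod [set: M] [set y]) [set: M].

Definition is_ideal A : Prop :=
  [/\ A !=set0, gprod [set: M] A `<=` A, gprod A [set: M] `<=` A &
      forall a b, A a -> b <= a -> A b].

Definition ideal_gen x : set M := smallest is_ideal [set x].

Definition Irel : M -> M -> Prop := fun a b => ideal_gen a = ideal_gen b.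

Definition semiprime T : Prop :=
  forall a g, Gamma M g -> T (g a a) -> T a.

Definition subsemigroup A : Prop := A !=set0 /\ gprod A A `<=` A.

Definition is_filter F : Prop :=
  [/\ subsemigroup F,
      forall a b g, Gamma M g -> F (g a b) -> F a /\ F b &
      forall a c, F a -> a <= c -> F c].

Definition filter_gen x : set M := smallest is_filter [set x].

Definition Nrel : M -> M -> Prop := fun a b => filter_gen a = filter_gen b.

Definition rclass sigma x : set M := [set y | sigma x y].

Definition congruence sigma : Prop :=
  RelationClasses.Equivalence sigma /\
  forall a b, sigma a b -> forall c g, Gamma M g ->
    sigma (g a c) (g b c) /\ sigma (g c a) (g c b).

Definition semilattice_congruence sigma : Prop :=
  [/\ congruence sigma,
      forall a b g, Gamma M g -> sigma (g a b) (g b a) &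
      forall a g, Gamma M g -> sigma (g a a) a].

(* [smallest] is an intersection; these show that it is attained. *)
Lemma ideal_gen_ideal x : is_ideal (ideal_gen x).
Proof.
split.
- by exists x => A [_]; apply.
- move=> _ [g Gg [a _ [b Ib <-]]] A [IA Ax]; have [_ + _ _] := IA; apply.
  by exists g => //; exists a => //; exists b => //; apply: Ib.
- move=> _ [g Gg [a Ia [b _ <-]]] A [IA Ax]; have [_ _ + _] := IA; apply.
  by exists g => //; exists a; [apply: Ia | exists b].
- move=> a b Ia ba A [IA Ax]; have [_ _ _ dA] := IA.
  by apply: dA ba; apply: Ia.
Qed.

Lemma filter_gen_filter x : is_filter (filter_gen x).
Proof.
split.
- split; first by exists x => A [_]; apply.
  move=> _ [g Gg [a Fa [b Fb <-]]] A [FA Ax]; have [[_ +] _ _] := FA; apply.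
  by exists g => //; exists a; [apply: Fa | exists b => //; apply: Fb].
- move=> a b g Gg Fab; split=> A [FA Ax]; have [_ + _] := FA;
    by case/(_ a b g Gg (Fab A (conj FA Ax))).
- move=> a c Fa ac A [FA Ax]; have [_ _ uA] := FA.
  by apply: uA ac; apply: Fa.
Qed.

End Notions.

Section Sub.
Context {d : Order.disp_t} {M : poGammaSemigroup d}.

Definition sub_carrier (A : set M) : Type := {x : M | x \in A}.
HB.instance Definition _ (A : set M) := SubChoice.on (sub_carrier A).
HB.instance Definition _ (A : set M) :=
  [SubChoice_isSubPOrder of sub_carrier A by <: with d].

Context (A : set M) (subA : subsemigroup A).

Definition sub_Gamma : set (sub_carrier A -> sub_carrier A -> sub_carrier A) :=
  [set h | exists2 g, Gamma M g & forall u v, val (h u v) = g (val u) (val v)].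

Lemma sub_carrier_nonempty : [set: sub_carrier A] !=set0.
Proof. by case: subA => -[a Aa] _; exists (exist _ a (mem_set Aa)). Qed.

Lemma sub_Gamma_nonempty : sub_Gamma !=set0.
Proof.
have [g Gg] := Gamma_nonempty M.
have gA (u v : sub_carrier A) : g (val u) (val v) \in A.
  apply/mem_set; case: subA => _; apply; exists g => //.
  exists (val u); first exact: set_mem (valP u).
  by exists (val v) => //; exact: set_mem (valP v).
by exists (fun u v => exist (fun x => x \in A) _ (gA u v)), g.
Qed.

Lemma sub_gammaA g m : sub_Gamma g -> sub_Gamma m ->
  forall a b c, m (g a b) c = g a (m b c).
Proof.
move=> [g' Gg gE] [m' Gm mE] a b c; apply: val_inj.
by rewrite mE gE gE mE (gammaA Gg Gm).
Qed.

Lemma sub_gamma_monor g : sub_Gamma g -> forall a b c, a <= b -> g a c <= g b c.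
Proof.
move=> [g' Gg gE] a b c; rewrite -!Order.le_val !gE.
exact: gamma_monor.
Qed.

Lemma sub_gamma_monol g : sub_Gamma g -> forall a b c, a <= b -> g c a <= g c b.
Proof.
move=> [g' Gg gE] a b c; rewrite -!Order.le_val !gE.
exact: gamma_monol.
Qed.

Definition sub_poGamma : poGammaSemigroup d :=
  PoGammaSemigroup sub_carrier_nonempty sub_Gamma_nonempty sub_gammaA
    sub_gamma_monor sub_gamma_monol.

End Sub.

Definition simple {d} (M : poGammaSemigroup d) : Prop :=
  forall I : set M, is_ideal I <-> I = [set: M].

Definition simple_subsemigroup {d} {M : poGammaSemigroup d} (A : set M) : Prop :=
  exists subA : subsemigroup A, simple (sub_poGamma subA).

Definition intra_regular {d} (M : poGammaSemigroup d) : Prop :=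
  forall (x : M) g, Gamma M g -> down (MxgxM g x) x.

Definition semilattice_of_simple {d} (M : poGammaSemigroup d) : Prop :=
  exists sigma : M -> M -> Prop, semilattice_congruence sigma /\
    forall x, simple_subsemigroup (rclass sigma x).

(* Main.v *)
Require Import Defs.
From mathcomp Require Import all_boot all_order.
From mathcomp Require Import boolp classical_sets.
Local Open Scope classical_set_scope.

(** Two facts carry the equivalence.

    First, intra-regularity says exactly that every ideal is semiprime
    ([intra_regularP]): if [A] is an ideal containing [g a a], then [A]
    contains [M Gamma (g a a) Gamma M], below an element of which [a] lies;
    conversely the elements below [M Gamma (g x x) Gamma M] form an ideal
    containing the fourth power of [x], hence [x].  A semiprime ideal cannot
    tell a product from the product in the opposite order, under any operation
    ([semiprime_swap]).  Applied to the ideal generated by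
    [M Gamma (g y z) Gamma M], this shows that the elements [y] with [x] below
    [M Gamma y Gamma M] are closed under products; they then form the filter
    generated by [x] ([semiprime_filter_gen]).

    Second, [Nrel x y] means that [x] and [y] lie in the same filters
    ([NrelP]), and a product lies in a filter iff both factors do
    ([filterP]).  So [Nrel] is a semilattice congruence, whatever [M].
    Since the complement of a filter is an ideal or empty, [Irel] always
    refines [Nrel]; the description of the generated filters gives the other
    inclusion, and then every ideal is a union of [Nrel]-classes.

    If every ideal is a union of [Nrel]-classes, each class is simple: when
    [Nrel z y], the ideal generated by [M Gamma z^3 Gamma M] meets the class,
    hence contains [y], so that [y <= (a z) z (z b)], where both outer factors
    are forced back into the class, by the filter property
    ([saturated_class_simple]).
    Finally, if the classes of a semilattice congruence are simple and an
    ideal contains [g a a], its trace on the class of [a] is an ideal of that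
    class, and so contains [a] ([semilattice_of_simple_semiprime]). *)

Set Implicit Arguments.
Unset Strict Implicit.
Unset Printing Implicit Defensive.
Local Open Scope order_scope.

Section PoGammaSemigroupTheory.
Context {d : Order.disp_t} {M : poGammaSemigroup d}.
Implicit Types (A B I F : set M) (x y z : M) (g h : M -> M -> M).

(** * Ideals and filters, elementwise *)

Lemma in_gprod A B g x y : Gamma M g -> A x -> B y -> gprod A B (g x y).
Proof. by move=> Gg Ax By; exists g => //; exists x => //; exists y. Qed.

Lemma idealP A : is_ideal A <->
  [/\ A !=set0,
      forall g x a, Gamma M g -> A a -> A (g x a) /\ A (g a x) &
      forall a b, A a -> b <= a -> A b].
Proof.
split=> [[A0 MA AM dA]|[A0 AA dA]]; split=> //.
- move=> g x a Gg Aa; split; first exact: MA (in_gprod Gg I Aa).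
  exact: AM (in_gprod Gg Aa I).
- by move=> _ [g Gg [x _ [a Aa <-]]]; case: (AA g x a Gg Aa).
- by move=> _ [g Gg [a Aa [x _ <-]]]; case: (AA g x a Gg Aa).
Qed.

Lemma ideal_mull A g x a : is_ideal A -> Gamma M g -> A a -> A (g x a).
Proof. by move=> /idealP[_ AA _] Gg /(AA g x a Gg)[]. Qed.

Lemma ideal_mulr A g x a : is_ideal A -> Gamma M g -> A a -> A (g a x).
Proof. by move=> /idealP[_ AA _] Gg /(AA g x a Gg)[]. Qed.

Lemma ideal_le A a b : is_ideal A -> A a -> b <= a -> A b.
Proof. by move=> /idealP[_ _]; apply. Qed.

Lemma filterP F : is_filter F <->
  [/\ F !=set0,
      forall g a b, Gamma M g -> F (g a b) <-> F a /\ F b &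
      forall a c, F a -> a <= c -> F c].
Proof.
split=> [[[F0 FF] Fl uF]|[F0 FM uF]].
  split=> // g a b Gg; split; first exact: Fl.
  by case=> Fa Fb; apply: FF; exact: in_gprod.
split=> //; first split=> //.
  by move=> _ [g Gg [a Fa [b Fb <-]]]; apply/FM.
by move=> a b g Gg /FM; apply.
Qed.

Lemma filter_mul F g : is_filter F -> Gamma M g ->
  forall a b, F (g a b) = (F a /\ F b).
Proof. by move=> /filterP[_ FM _] Gg a b; apply/propext/FM. Qed.

Lemma ideal_gen_id x : ideal_gen x x.
Proof. by move=> A [_]; apply. Qed.

Lemma filter_gen_id x : filter_gen x x.
Proof. by move=> A [_]; apply. Qed.

Lemma ideal_gen_min A x : is_ideal A -> A x -> ideal_gen x `<=` A.
Proof. by move=> iA Ax y; apply; split=> // _ ->. Qed.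

Lemma filter_gen_min F x : is_filter F -> F x -> filter_gen x `<=` F.
Proof. by move=> fF Fx y; apply; split=> // _ ->. Qed.

Arguments ideal_gen_id x : clear implicits.
Arguments filter_gen_id x : clear implicits.
Arguments ideal_mull {A g x a}.
Arguments ideal_mulr {A g x a}.
Arguments ideal_le {A a b}.

(** * The ideals of elements below M y M *)

Lemma down_MyMP y x : down (MyM y) x <->
  exists g h a b, [/\ Gamma M g, Gamma M h & x <= h (g a y) b].
Proof.
split=> [[_ [[h Gh [_ [g Gg [a _ [_ -> <-]]] [b _ <-]]] le_x]]|].
  by exists g, h, a, b.
move=> [g [h [a [b [Gg Gh le_x]]]]]; exists (h (g a y) b); split=> //.
by apply: in_gprod => //; exact: in_gprod.
Qed.

Lemma MxgxME g x : Gamma M g -> MxgxM g x = MyM (g x x).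
Proof.
move=> Gg; apply/seteqP; split=> w [k Gk].
  move=> [u [v [h Gh [a _ [_ -> <-]]] [_ -> <-]] [b _ <-]].
  by rewrite (gammaA Gh Gg); apply: in_gprod => //; exact: in_gprod.
move=> [u [h Gh [a _ [y -> <-]]] [b _ <-]].
rewrite -(gammaA Gh Gg); apply: in_gprod => //.
by exists (h a x); [exact: in_gprod|exists x].
Qed.

Lemma down_MyM_ideal y : is_ideal (down (MyM y)).
Proof.
apply/idealP; split.
- have [g Gg] := Gamma_nonempty M; exists (g (g y y) y).
  by apply/down_MyMP; exists g, g, y, y.
- move=> k x z Gk /down_MyMP[g [h [a [b [Gg Gh le_z]]]]].
  split; apply/down_MyMP.
    exists g, h, (k x a), b; split=> //.
    by rewrite (gammaA Gk Gg) (gammaA Gk Gh); exact: gamma_monol.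
  exists g, h, a, (k b x); split=> //.
  by rewrite -(gammaA Gh Gk); exact: gamma_monor.
- move=> z x [w [Mw le_zw]] le_xz; exists w; split=> //.
  exact: Order.POrderTheory.le_trans le_xz le_zw.
Qed.

Lemma down_MyM_mull g y z : Gamma M g -> down (MyM (g y z)) `<=` down (MyM y).
Proof.
move=> Gg x /down_MyMP[k [h [a [b [Gk Gh le_x]]]]]; apply/down_MyMP.
by exists k, g, a, (h z b); rewrite -(gammaA Gg Gh) (gammaA Gk Gg).
Qed.

Lemma down_MyM_mulr g y z : Gamma M g -> down (MyM (g y z)) `<=` down (MyM z).
Proof.
move=> Gg x /down_MyMP[k [h [a [b [Gk Gh le_x]]]]]; apply/down_MyMP.
by exists g, h, (k a y), b; rewrite (gammaA Gk Gg).
Qed.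

Lemma down_MyM_cube g y : Gamma M g -> down (MyM y) (g (g y y) y).
Proof. by move=> Gg; apply/down_MyMP; exists g, g, y, y. Qed.

Lemma filter_down_MyM F x y : is_filter F -> F x -> down (MyM y) x -> F y.
Proof.
move=> /filterP[_ FM uF] Fx /down_MyMP[g [h [a [b [Gg Gh /(uF _ _ Fx)]]]]].
by move=> /(FM _ _ _ Gh)[/(FM _ _ _ Gg)[]].
Qed.

(** * Semiprime ideals and intra-regularity *)

(** The square of [h b a] under [g] has [g a b] in its middle. *)
Lemma semiprime_swap A g h a b : is_ideal A -> semiprime A ->
  Gamma M g -> Gamma M h -> A (g a b) -> A (h b a).
Proof.
move=> iA sA Gg Gh Aab; apply: (sA _ g Gg).
rewrite (gammaA Gh Gg) -(gammaA Gg Gh).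
exact: (ideal_mull iA Gh (ideal_mulr iA Gh Aab)).
Qed.

Lemma intra_regularP :
  intra_regular M <-> forall I, is_ideal I -> semiprime I.
Proof.
split=> [irM A iA a g Gg Aaa|spM x g Gg].
  have := irM a g Gg; rewrite MxgxME // => /down_MyMP[h [k [u [v [Gh Gk]]]]].
  exact: ideal_le iA (ideal_mulr iA Gk (ideal_mull iA Gh Aaa)).
rewrite MxgxME //; have iJ := down_MyM_ideal (g x x).
apply: (spM _ iJ _ g) => //; apply: (spM _ iJ _ g) => //.
by apply/down_MyMP; exists g, g, x, x; split=> //; rewrite !(gammaA Gg Gg).
Qed.

Lemma semiprime_filter_gen x : (forall I, is_ideal I -> semiprime I) ->
  filter_gen x = [set y : M | down (MyM y) x].
Proof.
move=> spM; have [k Gk] := Gamma_nonempty M.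
(* The ideal below M y M contains the cube of y, hence its fourth power, from
   which two square roots lead to y. *)
have self y : down (MyM y) y.
  have iJ := down_MyM_ideal y.
  apply: (spM _ iJ _ k) => //; apply: (spM _ iJ _ k) => //.
  rewrite -(gammaA Gk Gk).
  exact: (ideal_mulr iJ Gk (down_MyM_cube _ Gk)).
apply/seteqP; split=> [|y xy]; last first.
  exact: (filter_down_MyM (filter_gen_filter x) (filter_gen_id x) xy).
apply: filter_gen_min; last exact: self.
apply/filterP; split.
- by exists x; exact: self.
- move=> g y z Gg; split=> [xyz|[]].
    by split; [apply: down_MyM_mull xyz|apply: down_MyM_mulr xyz].
  move=> /down_MyMP[g1 [h1 [a [b [Gg1 Gh1 le1]]]]].
  move=> /down_MyMP[g2 [h2 [a' [b' [Gg2 Gh2 le2]]]]].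
  pose J := down (MyM (g y z)); have iJ : is_ideal J := down_MyM_ideal _.
  have sJ := spM J iJ; apply: (sJ _ k) => //.
  have Jzy : J (h2 z (k b' (g1 a y))).
    rewrite -[k b' _](gammaA Gk Gg1).
    apply: (semiprime_swap iJ sJ Gg) => //.
    by rewrite (gammaA Gg1 Gg); exact: (ideal_mull iJ Gg1 (self _)).
  (* x is below a' z b' and below a y b, so the product of two copies of x is
     below one that contains z b' a y. *)
  have Jmid : J (k (h2 (g2 a' z) b') (h1 (g1 a y) b)).
    rewrite -(gammaA Gk Gh1) (gammaA Gg2 Gh2) (gammaA Gg2 Gk) (gammaA Gh2 Gk).
    exact: (ideal_mulr iJ Gh1 (ideal_mull iJ Gg2 Jzy)).
  apply: (ideal_le iJ Jmid).
  apply: Order.POrderTheory.le_trans (gamma_monor Gk _ le2) _.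
  exact: gamma_monol.
- move=> y z /down_MyMP[g [h [a [b [Gg Gh le_x]]]]] le_yz; apply/down_MyMP.
  exists g, h, a, b; split=> //; apply: Order.POrderTheory.le_trans le_x _.
  by apply: gamma_monor => //; exact: gamma_monol.
Qed.

(** * The relation N *)

Lemma NrelP x y : Nrel x y <-> forall F, is_filter F -> F x <-> F y.
Proof.
split=> [Nxy F fF|FE]; first split=> [Fx|Fy].
- by apply: (filter_gen_min fF Fx); rewrite Nxy; exact: filter_gen_id.
- by apply: (filter_gen_min fF Fy); rewrite -Nxy; exact: filter_gen_id.
- apply/seteqP; split; (apply: filter_gen_min; first exact: filter_gen_filter).
    exact: ((FE _ (filter_gen_filter y)).2 (filter_gen_id y)).
  exact: ((FE _ (filter_gen_filter x)).1 (filter_gen_id x)).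
Qed.

Lemma Nrel_semilattice : semilattice_congruence (@Nrel d M).
Proof.
split; first split.
- by split=> [x|x y|x y z]; rewrite /Nrel // => ->.
- move=> a b /NrelP Nab c g Gg; split; apply/NrelP => F fF;
    by rewrite !(filter_mul fF Gg) (propext (Nab F fF)).
- by move=> a b g Gg; apply/NrelP => F fF; rewrite !(filter_mul fF Gg); tauto.
- move=> a g Gg; apply/NrelP => F fF.
  by rewrite (filter_mul fF Gg); split=> [[]|].
Qed.

(** The complement of a filter, when it is nonempty, is an ideal. *)
Lemma Irel_sub_Nrel x y : Irel x y -> Nrel x y.
Proof.
have sub F a b : is_filter F -> ideal_gen a b -> F b -> F a.
  move=> /filterP[_ FM uF] Iab Fb; apply: contrapT => nFa.
  have iF : is_ideal (~` F).
    apply/idealP; split; first by exists a.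
      by move=> g u v Gg nFv; split=> /(FM _ _ _ Gg)[].
    by move=> u v nFu le_vu Fv; apply: nFu; exact: uF le_vu.
  by have /(_ b Iab) := ideal_gen_min iF nFa; apply.
move=> Ixy; apply/NrelP => F fF; split; apply: sub => //.
  by rewrite -Ixy; exact: ideal_gen_id.
by rewrite Ixy; exact: ideal_gen_id.
Qed.

Lemma filter_gen_Nrel_sub_Irel x y :
  (forall z : M, filter_gen z = [set y : M | down (MyM y) z]) ->
  Nrel x y -> Irel x y.
Proof.
move=> NE; have sub (a b : M) : Nrel a b -> ideal_gen a `<=` ideal_gen b.
  move=> Nab; have iI := ideal_gen_ideal b; apply: ideal_gen_min => //.
  have : filter_gen a b by rewrite Nab; exact: filter_gen_id.
  rewrite NE => /down_MyMP[g [h [u [v [Gg Gh]]]]].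
  exact: ideal_le iI (ideal_mulr iI Gh (ideal_mull iI Gg (ideal_gen_id b))).
by move=> Nxy; apply/seteqP; split; exact: sub.
Qed.

(** * Simple subsemigroups *)

(** Replaces the ideals of the semigroup carried by [A], which live in another
    type, by the subsets of [A] that absorb multiplication by [A] and lower
    bounds in [A]. *)
Lemma simple_subsemigroupP A : simple_subsemigroup A <->
  subsemigroup A /\
  forall B, B `<=` A -> B !=set0 ->
    (forall g a b, Gamma M g -> A a -> B b -> B (g a b) /\ B (g b a)) ->
    (forall a b, B a -> A b -> b <= a -> B b) -> A `<=` B.
Proof.
split=> [[subA simA]|[subA simA]].
  split=> // B BA [b Bb] BM dB a Aa.
  pose B' : set (sub_poGamma subA) := [set u | B (val u)].
  have B'T : B' = setT.
    apply/simA; split.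
    - by exists (exist _ b (mem_set (BA _ Bb))).
    - move=> _ [h [g Gg hE] [u _ [v Bv <-]]]; rewrite /B' /= hE.
      exact: (BM g _ _ Gg (set_mem (valP u)) Bv).1.
    - move=> _ [h [g Gg hE] [u Bu [v _ <-]]]; rewrite /B' /= hE.
      exact: (BM g _ _ Gg (set_mem (valP v)) Bu).2.
    - move=> u v Bu; rewrite -Order.le_val => le_vu.
      exact: dB Bu (set_mem (valP v)) le_vu.
  have : B' (exist _ a (mem_set Aa)) by rewrite B'T.
  by [].
exists subA => J; split=> [[J0 JMl JMr dJ]|->]; last first.
  by split=> //; exact: sub_carrier_nonempty.
have restr g : Gamma M g ->
    exists2 h, sub_Gamma h & forall u v : sub_carrier A,
      val (h u v) = g (val u) (val v).
  move=> Gg; have gA (u v : sub_carrier A) : g (val u) (val v) \in A.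
    apply/mem_set; have [_] := subA; apply.
    by apply: in_gprod => //; apply: set_mem; exact: valP.
  pose h (u v : sub_carrier A) : sub_carrier A :=
    exist (fun x => x \in A) _ (gA u v).
  by exists h => //; exists g.
have AJ : A `<=` [set val u | u in J].
  apply: simA.
  - by move=> _ [u _ <-]; exact: set_mem (valP u).
  - by case: J0 => u Ju; exists (val u); exists u.
  - move=> g a _ Gg Aa [u Ju <-]; have [h Gh hE] := restr g Gg.
    pose a' : sub_carrier A := exist _ a (mem_set Aa).
    split; [exists (h a' u)|exists (h u a')]; rewrite ?hE //.
      by apply: JMl; exists h => //; exists a' => //; exists u.
    by apply: JMr; exists h => //; exists u => //; exists a'.
  - move=> _ b [u Ju <-] Ab le_bu.
    exists (exist _ b (mem_set Ab)) => //; apply: dJ Ju _.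
    by rewrite -Order.le_val.
apply/seteqP; split=> // u _.
by have [v Jv /val_inj <-] := AJ _ (set_mem (valP u)).
Qed.

Lemma semilattice_class_subsemigroup (sigma : M -> M -> Prop) x :
  semilattice_congruence sigma -> subsemigroup (rclass sigma x).
Proof.
move=> [[[refl_s sym_s trans_s] cong] _ idem].
split; first by exists x; exact: refl_s.
move=> _ [g Gg [a sa [b sb <-]]]; rewrite /rclass /=.
apply: (trans_s _ _ _ (sym_s _ _ (idem x g Gg))).
exact: (trans_s _ _ _ (cong _ _ sa x g Gg).1 (cong _ _ sb a g Gg).2).
Qed.

(** The cube of [z] supplies one copy of [z], taken from the ideal of the class,
    and two more that pull the unknown outer factors into the class. *)
Lemma saturated_class_simple x :
  (forall I : set M, is_ideal I -> I = \bigcup_(x in I) rclass Nrel x) ->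
  simple_subsemigroup (rclass Nrel x).
Proof.
move=> satM; apply/simple_subsemigroupP; split.
  exact: semilattice_class_subsemigroup Nrel_semilattice.
move=> B BN [z Bz] BM dB y Ny; have Nz := BN z Bz.
have Nzy : Nrel z y by rewrite /Nrel -Nz.
have [k Gk] := Gamma_nonempty M.
pose z3 := k (k z z) z.
have iJ := down_MyM_ideal z3.
have Jy : down (MyM z3) y.
  rewrite (satM _ iJ); exists (k (k z3 z3) z3); first exact: down_MyM_cube.
  apply/NrelP => F fF; rewrite -(propext ((NrelP _ _).1 Nzy F fF)).
  by rewrite /z3 !(filter_mul fF Gk); tauto.
have /down_MyMP[g [h [a [b [Gg Gh le_y]]]]] := Jy.
have Fab F : is_filter F -> F y -> F a /\ F b.
  move=> /filterP[_ FM uF] Fy.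
  by have /(FM _ _ _ Gh)[/(FM _ _ _ Gg)[]] := uF _ _ Fy le_y.
have Naz : Nrel x (g a z).
  apply/NrelP => F fF; have := Fab F fF; have := (NrelP _ _).1 Ny F fF.
  by have := (NrelP _ _).1 Nz F fF; rewrite (filter_mul fF Gg); tauto.
have Nzb : Nrel x (h z b).
  apply/NrelP => F fF; have := Fab F fF; have := (NrelP _ _).1 Ny F fF.
  by have := (NrelP _ _).1 Nz F fF; rewrite (filter_mul fF Gh); tauto.
apply: (dB _ _ (BM k _ _ Gk Nzb (BM k _ _ Gk Naz Bz).1).2 Ny).
by rewrite -(gammaA Gk Gh) !(gammaA Gg Gk).
Qed.

Lemma semilattice_of_simple_semiprime I :
  semilattice_of_simple M -> is_ideal I -> semiprime I.
Proof.
move=> [sigma [[[[refl_s sym_s trans_s] cong] _ idem] simM]] iI a g Gg Iaa.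
have /simple_subsemigroupP[[_ CC] simC] := simM a.
have Ca : rclass sigma a a by exact: refl_s.
suff: rclass sigma a `<=` I `&` rclass sigma a by move=> /(_ a Ca)[].
apply: simC.
- by move=> x [].
- by exists (g a a); split=> //; apply: sym_s; exact: idem.
- move=> h x y Gh Cx [Iy Cy].
  by split; (split; last by apply: CC; exact: in_gprod);
    [exact: (ideal_mull iI)|exact: (ideal_mulr iI)].
- by move=> x y [Ix _] Cy le_yx; split=> //; exact: (ideal_le iI Ix).
Qed.

End PoGammaSemigroupTheory.

Theorem theorem8 (d : Order.disp_t) (M : poGammaSemigroup d) :
  [<-> intra_regular M;
       forall x : M, filter_gen x = [set y : M | down (MyM y) x];
       @Nrel d M = @Irel d M;
       forall I : set M, is_ideal I -> I = \bigcup_(x in I) rclass Nrel x;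
       forall x : M, simple_subsemigroup (rclass Nrel x);
       semilattice_of_simple M;
       forall I : set M, is_ideal I -> semiprime I].
Proof.
tfae.
- by move=> /intra_regularP spM x; exact: semiprime_filter_gen.
- move=> NE; apply/funext => x; apply/funext => y; apply/propext; split.
    exact: filter_gen_Nrel_sub_Irel.
  exact: Irel_sub_Nrel.
- move=> NI I iI; apply/seteqP; split=> [x Ix|y [x Ix]]; first by exists x.
  rewrite /rclass /= NI => Ixy; apply: (ideal_gen_min iI Ix).
  by rewrite Ixy; exact: ideal_gen_id.
- by move=> satM x; exact: saturated_class_simple.
- by move=> simM; exists Nrel; split=> //; exact: Nrel_semilattice.
- by move=> ssM I; exact: semilattice_of_simple_semiprime.
- by move=> spM; apply/intra_regularP.
Qed.
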